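(* Let $n$ be a composite even number and let $k$ be an odd divisor of $n$ with $2\le k\le n-1$. Let $D=\{d\in D_n\mid d \text{ even},\ k\nmid d\}\cup\{d\in D_n\mid d\text{ odd},\ k\mid d\}$. Then the adjacency spectrum of the integral circulant graph $\mathrm{ICG}_n(D)$ contains exactly four distinct eigenvalues.
   Context: For a positive integer $r$, $D_r$ denotes the set of positive divisors of $r$ other than $r$ itself. For $D\subseteq D_n$, the integral circulant graph $\mathrm{ICG}_n(D)$ is the graph on $\mathbb{Z}_n=\{0,\ldots,n-1\}$ in which $i$ and $j$ are adjacent iff $\gcd(i-j,n)\in D$. *)

(* Defs.v *)
From HB Require Import structures.
From mathcomp Require Export all_boot all_order all_algebra.

Set Implicit Arguments.
Unset Strict Implicit.
Unset Printing Implicit Defensive.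

Import GRing.Theory.

Definition proper_divisors (r : nat) : seq nat :=
  [seq d <- divisors r | d != r].

(* Vertices are the representatives 0, ..., n-1 of Z_n. The gcd of the integer
   i - j with n is taken on its absolute value; gcdn 0 n = n, so there is no
   loop when D is a subset of proper_divisors n. *)
Definition ICG (n : nat) (D : seq nat) : rel 'I_n :=
  fun i j => gcdn (absz (i%:Z - j%:Z)%R) n \in D.

Definition adjacency_mx (R : pzRingType) (n : nat) (e : rel 'I_n) : 'M[R]_n :=
  (\matrix_(i, j) (e i j)%:R)%R.

Definition Dset (n k : nat) : seq nat :=
  [seq d <- proper_divisors n | ~~ odd d && ~~ (k %| d)] ++
  [seq d <- proper_divisors n | odd d && (k %| d)].

Lemma ICG_sym n D : symmetric (@ICG n D).
Proof. by move=> i j; rewrite /ICG distnC. Qed.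

Lemma ICG_irrefl n D :
  {subset D <= proper_divisors n} -> irreflexive (@ICG n D).
Proof.
move=> sD i; rewrite /ICG subrr gcd0n; apply/negP => /sD.
by rewrite mem_filter eqxx.
Qed.

Lemma Dset_sub n k : {subset Dset n k <= proper_divisors n}.
Proof.
by move=> d; rewrite mem_cat => /orP[]; rewrite mem_filter => /andP[].
Qed.

(* Main.v *)
Require Import Defs.
From mathcomp Require Import all_boot all_order all_algebra.
From mathcomp Require Import ring.

(** Let [M d] be the matrix of congruence modulo [d] and write [n = 2 k m].
    The adjacency matrix is [A = M 2 + M k - 2 M (2k)].  By the Chinese
    remainder theorem the span of [M 1], [M 2], [M k], [M (2k)] is stable under
    multiplication by [A], which acts on it triangularly with diagonal
    [m k], [m (k - 2)], [0], [- 2 m]: these are the only eigenvalues of [A], and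
    diagonalizing this action gives a nonzero matrix of eigenvectors for each. *)

Set Implicit Arguments.
Unset Strict Implicit.
Unset Printing Implicit Defensive.

Import Order.TTheory GRing.Theory Num.Theory.

(** Each block of [d] consecutive integers meets the class of [c] exactly once; the induction peels
    off the last block. *)
Lemma sum_eq_mod (d m c : nat) : (0 < d)%N ->
  (\sum_(x < m * d) (x == c %[mod d]) = m)%N.
Proof.
move=> d_gt0; elim: m => [|m IHm]; first by rewrite big_ord0.
rewrite mulSn addnC big_split_ord /= IHm -addn1; congr addn.
rewrite (bigD1 (Ordinal (ltn_pmod c d_gt0))) //= modnMDl modn_mod eqxx.
rewrite big1 // => i; rewrite -val_eqE /= modnMDl (modn_small (ltn_ord i)).
by move/negbTE->.
Qed.

Lemma eqn_mod_dvd_dist (d i j : nat) :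
  (i == j %[mod d]) = (d %| absz (i%:Z - j%:Z)%R).
Proof.
have -> : (d %| absz (i%:Z - j%:Z)%R) = (d%:Z %| (i%:Z - j%:Z)%R)%Z by [].
by rewrite -eqz_mod_dvd !modz_nat.
Qed.

(** Any nonzero vector in the row space of [X] is an eigenvector, so a nonzero matrix can serve as
    witness. *)
Lemma eigenvalue_mulmx (F : fieldType) (m n : nat) (A : 'M[F]_n)
  (X : 'M[F]_(m, n)) (a : F) : (X *m A = a *: X -> X != 0 -> eigenvalue A a)%R.
Proof.
move=> XA /rowV0Pn[v vX v_neq0]; apply/eigenvalueP; exists v => //.
by have /submxP[u ->] := vX; rewrite -mulmxA XA scalemxAr.
Qed.

(** Since 2 and [k] divide [n], taking the gcd with [n] preserves divisibility by either. The
    excluded divisor [n] is a multiple of both, where the exclusive or is false anyway. *)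
Lemma mem_Dset (n k x : nat) : (0 < n)%N -> ~~ odd n -> k %| n ->
  (gcdn x n \in Dset n k) = (2 %| x) (+) (k %| x).
Proof.
move=> n_gt0 n_even k_dvd; have n_dvd2 : 2 %| n by rewrite dvdn2.
have in_div : gcdn x n \in divisors n by rewrite -dvdn_divisors ?dvdn_gcdr.
have dvd2_gcd : (2 %| gcdn x n) = (2 %| x) by rewrite dvdn_gcd n_dvd2 andbT.
have dvdk_gcd : (k %| gcdn x n) = (k %| x) by rewrite dvdn_gcd k_dvd andbT.
rewrite mem_cat !mem_filter in_div andbT.
rewrite -dvd2_gcd -dvdk_gcd dvdn2; have [->|_] := eqVneq (gcdn x n) n.
  by rewrite n_even k_dvd !andbF.
by case: (odd _); case: (k %| _).
Qed.

Local Open Scope ring_scope.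

Section CongruenceMatrix.
Variables (R : comPzRingType) (n : nat).

Definition cong_mx (d : nat) : 'M[R]_n :=
  \matrix_(i, j) ((i == j %[mod d])%N)%:R.

(** The entry counts the [x < n] satisfying both congruences; a single class modulo [d] has
    [n / d = m] members there. *)
Lemma cong_mx_mul_entry (d1 d2 d m : nat) (i j : 'I_n) (c : nat) :
  (0 < d)%N -> n = (m * d)%N ->
  (forall x : nat, ((i == x %[mod d1]) && (x == j %[mod d2]))%N
                   = (x == c %[mod d])%N) ->
  (cong_mx d1 *m cong_mx d2) i j = m%:R.
Proof.
move=> d_gt0 n_eq congE; rewrite mxE -[in RHS](sum_eq_mod m c d_gt0) -n_eq natr_sum.
by apply: eq_bigr => x _; rewrite !mxE -natrM mulnb congE.
Qed.

Lemma cong_mx_mul_dvd (d1 d2 m : nat) :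
  (0 < d2)%N -> (d1 %| d2)%N -> n = (m * d2)%N ->
  cong_mx d1 *m cong_mx d2 = m%:R *: cong_mx d1.
Proof.
move=> d2_gt0 d12 n_eq; apply/matrixP => i j; rewrite [RHS]mxE [in RHS]mxE.
have xj_mod x : (x == j %[mod d2])%N -> (x == j %[mod d1])%N.
  by move/eqP => xj; rewrite -(modn_dvdm x d12) xj modn_dvdm.
have [ij|ij] := boolP (_ == _ %[mod d1])%N.
  rewrite mulr1; apply: (cong_mx_mul_entry (c := j) d2_gt0 n_eq) => x.
  apply: andb_idl => /xj_mod /eqP ->; exact: ij.
rewrite mulr0 mxE big1 // => x _; rewrite !mxE -natrM mulnb.
have [/xj_mod /eqP ->|_] := boolP (x == j %[mod d2])%N; last by rewrite andbF.
by rewrite (negbTE ij).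
Qed.

(** By the Chinese remainder theorem the two congruences define one class modulo [d1 * d2], whatever
    [i] and [j] are; [cong_mx 1] is the all-ones matrix. *)
Lemma cong_mx_mul_coprime (d1 d2 m : nat) :
  (0 < d1)%N -> (0 < d2)%N -> coprime d1 d2 -> n = (m * (d1 * d2))%N ->
  cong_mx d1 *m cong_mx d2 = m%:R *: cong_mx 1.
Proof.
move=> d1_gt0 d2_gt0 co12 n_eq; apply/matrixP => i j.
rewrite [RHS]mxE [in RHS]mxE !modn1 eqxx mulr1.
have d_gt0 : (0 < d1 * d2)%N by rewrite muln_gt0 d1_gt0.
apply: (cong_mx_mul_entry (c := chinese d1 d2 i j) d_gt0 n_eq) => x.
by rewrite chinese_remainder // chinese_modl // chinese_modr // [X in X && _]eq_sym.
Qed.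

Lemma cong_mx_tr (d : nat) : (cong_mx d)^T = cong_mx d.
Proof. by apply/matrixP => i j; rewrite !mxE eq_sym. Qed.

Lemma cong_mx_mul_dvdr (d1 d2 m : nat) :
  (0 < d2)%N -> (d1 %| d2)%N -> n = (m * d2)%N ->
  cong_mx d2 *m cong_mx d1 = m%:R *: cong_mx d1.
Proof.
move=> d2_gt0 d12 n_eq; apply: trmx_inj.
by rewrite trmx_mul linearZ /= !cong_mx_tr (cong_mx_mul_dvd d2_gt0 d12 n_eq).
Qed.

(** The exclusive or of truth values [p], [q] is [p + q - 2 p q], and for odd [k] the product [p q]
    is divisibility by [2 * k]. *)
Lemma adjacency_ICG_Dset (k : nat) : (0 < n)%N -> ~~ odd n -> odd k -> (k %| n)%N ->
  adjacency_mx R (@ICG n (Dset n k))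
  = cong_mx 2 + cong_mx k - 2%:R *: cong_mx (2 * k).
Proof.
move=> n_gt0 n_even k_odd k_dvd; apply/matrixP => i j.
rewrite !mxE /ICG mem_Dset // !eqn_mod_dvd_dist Gauss_dvd ?coprime2n //.
by case: (2 %| _)%N; case: (k %| _)%N => /=; ring.
Qed.

End CongruenceMatrix.

Theorem theorem4p6 (C : numClosedFieldType) (n k : nat)
  (n_gt1 : (1 < n)%N) (n_composite : ~~ prime n) (n_even : ~~ odd n)
  (k_odd : odd k) (k_dvd : (k %| n)%N) (k_bounds : (2 <= k <= n - 1)%N) :
  exists s : seq C,
    uniq s /\ size s = 4%N /\
    (forall a : C,
       eigenvalue (adjacency_mx C (@ICG n (Dset n k))) a <-> a \in s).
Proof.
have n_gt0 : (0 < n)%N by apply: ltnW.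
(* Oddness rules out [k = 2], for which [m (k - 2)] would coincide with the eigenvalue 0. *)
have k_gt2 : (2 < k)%N by move: k_odd k_bounds; case: k {k_dvd} => [|[|[|]]].
have k_gt0 : (0 < k)%N by apply: leq_trans k_gt2.
have co2k : coprime 2 k by rewrite coprime2n.
have /dvdnP[m n_eq] : (2 * k %| n)%N by rewrite Gauss_dvd // dvdn2 n_even.
have m_gt0 : (0 < m)%N by case: m n_eq n_gt0 => // ->.
have n_eq2 : n = (m * k * 2)%N by rewrite n_eq; ring.
have n_eqk : n = (m * 2 * k)%N by rewrite n_eq; ring.
have kk_gt0 : (0 < 2 * k)%N by rewrite muln_gt0.
rewrite adjacency_ICG_Dset //; set A : 'M[C]_n := _ - _.
pose J : 'M[C]_n := cong_mx C n 1; pose E : 'M[C]_n := cong_mx C n 2.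
pose K : 'M[C]_n := cong_mx C n k; pose P : 'M[C]_n := cong_mx C n (2 * k).
have mulA (X : 'M[C]_n) : X *m A = X *m E + X *m K - 2%:R *: (X *m P).
  by rewrite mulmxBr mulmxDr scalemxAr.
have two_gt0 : (0 < 2)%N by [].
have EE : E *m E = (m * k)%:R *: E by apply: cong_mx_mul_dvd.
have KK : K *m K = (m * 2)%:R *: K by apply: cong_mx_mul_dvd.
have PP : P *m P = m%:R *: P by apply: cong_mx_mul_dvd.
have JE : J *m E = (m * k)%:R *: J by apply: cong_mx_mul_dvd.
have JK : J *m K = (m * 2)%:R *: J by apply: cong_mx_mul_dvd.
have JP : J *m P = m%:R *: J by apply: cong_mx_mul_dvd.
have EP : E *m P = m%:R *: E by apply: cong_mx_mul_dvd; rewrite ?dvdn_mulr.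
have KP : K *m P = m%:R *: K by apply: cong_mx_mul_dvd; rewrite ?dvdn_mull.
have PE : P *m E = m%:R *: E by apply: cong_mx_mul_dvdr; rewrite ?dvdn_mulr.
have PK : P *m K = m%:R *: K by apply: cong_mx_mul_dvdr; rewrite ?dvdn_mull.
have EK : E *m K = m%:R *: J by apply: cong_mx_mul_coprime.
have KE : K *m E = m%:R *: J.
  by apply: cong_mx_mul_coprime; rewrite 1?coprime_sym // (mulnC k).
have JA : J *m A = (m%:R * k%:R) *: J.
  by rewrite mulA JE JK JP; apply/matrixP => i j; rewrite !mxE; ring.
have EA : E *m A = (m%:R * (k%:R - 2%:R)) *: E + m%:R *: J.
  by rewrite mulA EE EK EP; apply/matrixP => i j; rewrite !mxE; ring.
(* The contributions [2 m K] of [K *m K] and [2 (K *m P)] cancel, whence the eigenvalue 0. *)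
have KA : K *m A = m%:R *: J.
  by rewrite mulA KE KK KP; apply/matrixP => i j; rewrite !mxE; ring.
have PA : P *m A = m%:R *: E + m%:R *: K - (2%:R * m%:R) *: P.
  by rewrite mulA PE PK PP; apply/matrixP => i j; rewrite !mxE; ring.
(* By symmetry, the products with [A] on the left follow by transposition; they serve to exclude
   further eigenvalues. *)
have trA : A^T = A by rewrite /A !linearD !linearN !linearZ /= !cong_mx_tr.
have commA (d : nat) : A *m cong_mx C n d = (cong_mx C n d *m A)^T.
  by rewrite trmx_mul trA cong_mx_tr.
have AJ : A *m J = (m%:R * k%:R) *: J by rewrite commA JA linearZ /= cong_mx_tr.
have AE : A *m E = (m%:R * (k%:R - 2%:R)) *: E + m%:R *: J.
  by rewrite commA EA linearD !linearZ /= !cong_mx_tr.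
have AK : A *m K = m%:R *: J by rewrite commA KA linearZ /= cong_mx_tr.
have AP : A *m P = m%:R *: E + m%:R *: K - (2%:R * m%:R) *: P.
  by rewrite commA PA linearB linearD !linearZ /= !cong_mx_tr.
(* At this diagonal position a combination of congruence matrices has its coefficient sum as entry,
   which will show the witnesses nonzero. *)
pose i0 := Ordinal n_gt0.
have diag d : cong_mx C n d i0 i0 = 1 by rewrite mxE eqxx.
have m_gt0C : 0 < m%:R :> C by rewrite ltr0n.
have k_gt2C : 2%:R < k%:R :> C by rewrite ltr_nat.
have k1_neq0 : k%:R - 1 != 0 :> C.
  by rewrite subr_eq0 pnatr_eq1 gtn_eqF // ltnW.
have nz (X : 'M[C]_n) : X i0 i0 != 0 -> X != 0.
  by apply: contraNneq => ->; rewrite mxE.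
have mk2_gt0 : 0 < m%:R * (k%:R - 2%:R) :> C by rewrite mulr_gt0 // subr_gt0.
have mk2_lt : m%:R * (k%:R - 2%:R) < m%:R * k%:R :> C.
  by rewrite ltr_pM2l // ltrBlDr ltrDl.
have m2_lt0 : - (2%:R * m%:R) < 0 :> C by rewrite oppr_lt0 mulr_gt0.
exists [:: m%:R * k%:R; m%:R * (k%:R - 2%:R); 0; - (2%:R * m%:R)]; split.
  (* Distinctness comes from [- 2 m < 0 < m (k - 2) < m k]. *)
  have lt1 := lt_trans mk2_gt0 mk2_lt; have lt2 := lt_trans m2_lt0 mk2_gt0.
  rewrite /= !inE !negb_or (gt_eqF mk2_lt) (gt_eqF lt1) (gt_eqF mk2_gt0).
  by rewrite (gt_eqF m2_lt0) (gt_eqF lt2) (gt_eqF (lt_trans m2_lt0 lt1)).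
split=> // a; split; last first.
  rewrite !inE => /or4P[] /eqP ->.
  - by apply: (eigenvalue_mulmx JA); rewrite nz // diag oner_neq0.
  (* The multiple of [J] is chosen to cancel the off-diagonal term [m J], with denominators cleared;
     the next two witnesses arise likewise. *)
  - apply: (@eigenvalue_mulmx _ _ _ _ (2%:R *: E - J)).
      rewrite mulmxBl -scalemxAl EA JA; apply/matrixP => i j; rewrite !mxE; ring.
    by rewrite nz // !mxE !eqxx /= mulr1 (addrK 1 1) oner_neq0.
  - apply: (@eigenvalue_mulmx _ _ _ _ (k%:R *: K - J)).
      rewrite mulmxBl -scalemxAl KA JA; apply/matrixP => i j; rewrite !mxE; ring.
    by rewrite nz // !mxE !eqxx mulr1.
  - apply: (@eigenvalue_mulmx _ _ _ _
      ((2%:R * k%:R) *: P - 2%:R *: E - k%:R *: K + J)).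
      rewrite mulmxDl !mulmxBl -!scalemxAl PA EA KA JA.
      apply/matrixP => i j; rewrite !mxE; ring.
    rewrite nz // !mxE !eqxx /=.
    by have -> : 2%:R * k%:R * 1 - 2%:R * 1 - k%:R * 1 + 1 = k%:R - 1 :> C by ring.
case/eigenvalueP => v vA; apply: contraNT.
rewrite !inE !negb_or => /and4P[a_mk a_mk2 a_0 a_m2].
have vAX (X : 'M[C]_n) : v *m (A *m X) = a *: (v *m X).
  by rewrite mulmxA vA scalemxAl.
have eig0 (b : C) (u : 'rV[C]_n) : a != b -> a *: u = b *: u -> u = 0.
  move=> ab /eqP; rewrite -subr_eq0 -scalerBl scaler_eq0 subr_eq0 (negbTE ab).
  by move/eqP.
(* Triangularity makes [v] annihilate [J], then [K] and [E], then [P], since [a] avoids each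
   diagonal coefficient. *)
have vJ : v *m J = 0.
  by apply: (eig0 _ _ a_mk); rewrite -vAX AJ scalemxAr.
have vK : v *m K = 0.
  by apply: (eig0 _ _ a_0); rewrite -vAX AK -scalemxAr vJ scaler0 scale0r.
have vE : v *m E = 0.
  by apply: (eig0 _ _ a_mk2); rewrite -vAX AE mulmxDr -!scalemxAr vJ scaler0 addr0.
have vP : v *m P = 0.
  apply: (eig0 _ _ a_m2); rewrite -vAX AP mulmxBr mulmxDr -!scalemxAr vK vE.
  by rewrite !scaler0 addr0 sub0r scaleNr.
(* Now [a v = v A = 0] with [a] nonzero, so [v = 0]. *)
apply/eqP; apply: (eig0 _ _ a_0); rewrite -vA scale0r mulmxBr mulmxDr -scalemxAr.
by rewrite -/E -/K -/P vE vK vP scaler0 addr0 subr0.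
Qed.
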